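(* For every $n\ge1$, $$\#\{A\in\mathcal{A}(\mathsf{A}^n):\ \mathrm{LK}(\mathrm{row}_{\mathcal{A}}(A))=A\}=\binom{n+1}{\lfloor (n+1)/2\rfloor}.$$
   Context: $\mathsf{A}^n$ is the poset of intervals $[i,j]=\{i,\dots,j\}$, $1\le i\le j\le n$, ordered by inclusion; $\mathcal{A}(\mathsf{A}^n)$ is its set of antichains. For an antichain $A=\{[i_1,j_1],\dots,[i_k,j_k]\}$ with $i_1<\dots<i_k$ (hence $j_1<\dots<j_k$), $\mathrm{LK}(A)=\{[i'_1,j'_1],\dots,[i'_m,j'_m]\}$ where $\{i'_1<\dots<i'_m\}=\{1,\dots,n\}\setminus\{j_1,\dots,j_k\}$ and $\{j'_1<\dots<j'_m\}=\{1,\dots,n\}\setminus\{i_1,\dots,i_k\}$. Antichain rowmotion: $\mathrm{row}_{\mathcal{A}}(A)$ is the set of minimal elements of $\{x\in\mathsf{A}^n: x\not\le y\text{ for all }y\in A\}$. *)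

(* Defs.v *)
From HB Require Import structures.
From mathcomp Require Import all_boot all_order.

Set Implicit Arguments.
Unset Strict Implicit.
Unset Printing Implicit Defensive.

Import Order.TTheory.

Section FinitePoset.
Variables (d : Order.disp_t) (T : finPOrderType d).
Implicit Types A S : {set T}.

Definition antichain A : bool :=
  [forall x in A, forall y in A, (x <= y)%O ==> (x == y)].

Definition minimals S : {set T} :=
  [set x in S | [forall y in S, (y <= x)%O ==> (y == x)]].

Definition rowA A : {set T} :=
  minimals [set x : T | [forall y in A, ~~ (x <= y)%O]].

End FinitePoset.

(* The ground set {1, .., n} is represented by 'I_n, k being coded by k - 1;
   everything below depends only on the order of the ground set. *)
Record interval (n : nat) := Interval {
  endpoints : 'I_n * 'I_n;
  _ : endpoints.1 <= endpoints.2
}.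

HB.instance Definition _ n := [isSub for @endpoints n].
HB.instance Definition _ n := [Finite of interval n by <:].

Definition lo n (x : interval n) : 'I_n := (endpoints x).1.
Definition hi n (x : interval n) : 'I_n := (endpoints x).2.

Definition points n (x : interval n) : {set 'I_n} :=
  [set k : 'I_n | lo x <= k <= hi x].

Definition interval_le n : rel (interval n) :=
  fun x y => points x \subset points y.

Lemma interval_leE n (x y : interval n) :
  interval_le x y = (lo y <= lo x) && (hi x <= hi y).
Proof.
have lox : lo x <= hi x := valP x.
apply/subsetP/andP => [sxy | [lyx hxy] k].
  have := sxy (lo x); have := sxy (hi x).
  by rewrite !inE !leqnn lox => /(_ isT)/andP[_ ->] /(_ isT)/andP[->].
rewrite !inE => /andP[lk kh].
by rewrite (leq_trans lyx lk) (leq_trans kh hxy).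
Qed.

Lemma interval_le_refl n : reflexive (@interval_le n).
Proof. by move=> x; rewrite /interval_le. Qed.

Lemma interval_le_anti n : antisymmetric (@interval_le n).
Proof.
move=> x y; rewrite !interval_leE => /andP[/andP[l1 h1] /andP[l2 h2]].
have el : lo x = lo y by apply/val_inj/eqP; rewrite eqn_leq l1 l2.
have eh : hi x = hi y by apply/val_inj/eqP; rewrite eqn_leq h1 h2.
apply: val_inj; change (endpoints x = endpoints y).
by rewrite [LHS]surjective_pairing [RHS]surjective_pairing; congr (_, _).
Qed.

Lemma interval_le_trans n : transitive (@interval_le n).
Proof. by move=> y x z; apply: subset_trans. Qed.

Fact interval_display : Order.disp_t.
Proof. exact: (Order.Disp tt tt). Qed.

HB.instance Definition _ n :=
  Order.Le_isPOrder.Build interval_display (interval n)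
    (@interval_le_refl n) (@interval_le_anti n) (@interval_le_trans n).

(* [enum] lists a set of ordinals in increasing order, so [LK_pairs A] is
   (i'_1, j'_1), .., (i'_m, j'_m). *)
Definition LK_pairs n (A : {set interval n}) : seq ('I_n * 'I_n) :=
  zip (enum (~: [set hi x | x in A])) (enum (~: [set lo x | x in A])).

Definition LK n (A : {set interval n}) : {set interval n} :=
  [set x : interval n | (lo x, hi x) \in LK_pairs A].

Lemma enum_ord_sorted n (S : {set 'I_n}) :
  sorted (fun i j : 'I_n => i < j) (enum S).
Proof.
rewrite {1}/enum_mem; apply: sorted_filter => [y x z|]; first exact: ltn_trans.
by have := iota_ltn_sorted 0 n; rewrite -val_enum_ord sorted_map -enumT.
Qed.

Lemma zip_enum_leq n (S S' : {set 'I_n}) p :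
    (forall t : 'I_n, #|[set k in S' | k <= t]| <= #|[set k in S | k <= t]|) ->
  p \in zip (enum S) (enum S') -> p.1 <= p.2.
Proof.
have cntE (U : {set 'I_n}) (t : 'I_n) :
    #|[set k in U | k <= t]| = count (fun k : 'I_n => k <= t) (enum U).
  rewrite -size_filter cardE; congr size.
  rewrite /enum_mem -filter_predI; apply: eq_filter => k.
  by rewrite /= !inE andbC.
have tr : transitive (fun i j : 'I_n => i < j).
  by move=> y x z; apply: ltn_trans.
move=> leS /(nthP p)[l]; rewrite size_zip leq_min => /andP[lS lS'] <-.
rewrite (surjective_pairing p) nth_zip_cond size_zip leq_min lS lS' /=.
set a := nth _ _ _; set b := nth _ _ _; rewrite leqNgt; apply/negP => ltba.
have := leS b; rewrite !cntE; apply/negP; rewrite -ltnNge.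
apply: (@leq_ltn_trans l).
  rewrite -{1}(cat_take_drop l (enum S)) count_cat.
  rewrite [X in _ + X](_ : _ = 0) ?addn0.
    by apply: leq_trans (count_size _ _) _; rewrite size_take lS.
  apply/eqP; rewrite -leqn0 leqNgt -has_count -all_predC.
  apply/(all_nthP p.1) => i; rewrite size_drop ltn_subRL nth_drop => li /=.
  rewrite -ltnNge; apply: leq_trans ltba _.
  case: i li => [|i] li; first by rewrite addn0.
  apply: ltnW; apply: (sorted_ltn_nth tr p.1 (enum_ord_sorted S)) => //.
  by rewrite addnS ltnS leq_addr.
rewrite -(cat_take_drop l.+1 (enum S')) count_cat.
apply: leq_trans (leq_addr _ _).
have := all_count (fun k : 'I_n => k <= b) (take l.+1 (enum S')).
suff -> : all (fun k : 'I_n => k <= b) (take l.+1 (enum S')).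
  by rewrite size_takel // => /esym/eqP->.
apply/(all_nthP p.2) => i; rewrite size_takel // => il; rewrite nth_take //.
case: (eqVneq i l) => [-> //|ne].
have {ne}il : i < l by rewrite ltn_neqAle ne.
apply: ltnW; apply: (sorted_ltn_nth tr p.2 (enum_ord_sorted S')) => //.
exact: ltn_trans il _.
Qed.

(* On antichains [LK] loses nothing: the two lists zipped in [LK_pairs] have
   the same length, and every zipped pair is an interval. *)
Section LKWellDefined.
Variables (n : nat) (A : {set interval n}).
Hypothesis acA : antichain A.

Lemma antichainP x y : x \in A -> y \in A -> interval_le x y -> x = y.
Proof.
by move=> xA yA xy; move/forall_inP/(_ x xA)/forall_inP/(_ y yA): acA => /implyP/(_ xy)/eqP.
Qed.

Lemma lo_inj_in : {in A &, injective (@lo n)}.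
Proof.
move=> x y xA yA e; case: (leqP (hi x) (hi y)) => h.
  by apply: antichainP => //; rewrite interval_leE e leqnn.
by apply/esym/antichainP => //; rewrite interval_leE e leqnn ltnW.
Qed.

Lemma hi_inj_in : {in A &, injective (@hi n)}.
Proof.
move=> x y xA yA e; case: (leqP (lo y) (lo x)) => h.
  by apply: antichainP => //; rewrite interval_leE e leqnn h.
by apply/esym/antichainP => //; rewrite interval_leE e leqnn ltnW.
Qed.

Lemma LK_size :
  size (enum (~: [set hi x | x in A])) = size (enum (~: [set lo x | x in A])).
Proof.
rewrite -!cardE [LHS]cardsCs [RHS]cardsCs !setCK.
by rewrite (card_in_imset hi_inj_in) (card_in_imset lo_inj_in).
Qed.

Lemma LK_pairs_interval p : p \in LK_pairs A -> p.1 <= p.2.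
Proof.
apply: zip_enum_leq => t.
have cC (U : {set 'I_n}) :
    #|[set k in ~: U | k <= t]| = #|[set k : 'I_n | k <= t]| - #|[set k in U | k <= t]|.
  rewrite (_ : [set k in ~: U | k <= t] = [set k : 'I_n | k <= t] :\: [set k in U | k <= t]).
    rewrite cardsDS //; by apply/subsetP => k; rewrite !inE => /andP[].
  by apply/setP => k; rewrite !inE; case: (k \in U); case: (_ <= _).
rewrite !cC; apply: leq_sub2l.
pose B := [set x in A | hi x <= t].
have -> : [set k in [set hi x | x in A] | k <= t] = [set hi x | x in B].
  apply/setP => k; rewrite inE; apply/andP/imsetP => [[/imsetP[x xA ->] kt]|[x]].
    by exists x => //; rewrite inE xA.
  by rewrite inE => /andP[xA xt] ->; rewrite imset_f.
have BA : {subset B <= A} by move=> x; rewrite inE => /andP[].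
have -> : #|[set hi x | x in B]| = #|[set lo x | x in B]|.
  rewrite !card_in_imset // => x y /BA xA /BA yA; first exact: lo_inj_in.
  exact: hi_inj_in.
apply/subset_leq_card/subsetP => _ /imsetP[x + ->]; rewrite !inE => /andP[xA xt].
by rewrite imset_f //=; apply: leq_trans xt; apply: (valP x).
Qed.

End LKWellDefined.

(* Main.v *)
Require Import Defs.
From mathcomp Require Import all_boot all_order zify.

Set Implicit Arguments.
Unset Strict Implicit.
Unset Printing Implicit Defensive.

(** Read an antichain [A] along the [n + 1] gaps of [{1, .., n}] (including the
    two outer ones): a gap is marked up if an interval of [A] starts just after
    it and down if one ends just before it. The right ends of [row A] are the
    points not covered by [A] and the successors of the right ends of [A], and
    dually for the left ends. Hence [LK (row A) = A] says exactly that every gap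
    met by or adjacent to an interval of [A] carries precisely one of the two
    marks. The fixed antichains thus correspond to the words of length [n + 1]
    in up, down and flat steps that form a nonnegative path from 0 to 0 with
    flat steps only at height 0. More generally, by Pascal's rule, there are
    [C(m, floor((m - h) / 2))] such words of length [m] starting at height
    [h <= m]. *)

(** * Counting the words by length and starting height *)

Notation up := (Some true).
Notation down := (Some false).
Notation flat := None.

(* The nonnegative paths from height [h] to 0 whose flat steps are at height 0. *)
Fixpoint good (h : nat) (w : seq (option bool)) : bool :=
  match w with
  | [::] => h == 0
  | up :: w' => good h.+1 w'
  | down :: w' => (0 < h) && good h.-1 w'
  | flat :: w' => (h == 0) && good 0 w'
  end.

Lemma card_tupleS (T : finType) (m : nat) (P : pred (seq T)) :
  #|[set t : m.+1.-tuple T | P t]| =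
    \sum_(x : T) #|[set t : m.-tuple T | P (x :: t)]|.
Proof.
rewrite -sum1dep_card (partition_big (@thead _ _) predT) //=.
apply: eq_bigr => x _; rewrite -sum1dep_card.
rewrite (reindex_onto (fun t : m.-tuple T => [tuple of x :: t])
                      (fun t => [tuple of behead t])) /=.
  by apply: eq_bigl => t; rewrite theadE eqxx andbT -val_eqE /= eqxx andbT.
by move=> t /andP[_ /eqP<-]; rewrite [t in RHS]tuple_eta; apply: val_inj.
Qed.

(** Induction on the first letter: at positive height the up and down steps supply the two terms of
    Pascal's rule, at height 0 the up and flat steps do. *)
Lemma card_good (m h : nat) :
  #|[set t : m.-tuple (option bool) | good h t]| =
    if h <= m then 'C(m, (m - h)./2) else 0.
Proof.
elim: m h => [|m IHm] h.
  have [->|h_neq0] := eqVneq h 0; last first.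
    rewrite leqn0 (negbTE h_neq0); apply/eqP; rewrite cards_eq0 -subset0.
    by apply/subsetP => t; rewrite inE tuple0 /= (negbTE h_neq0).
  rewrite bin0 -[RHS](card_tuple 0 (option bool)) -cardsT.
  by congr #|pred_of_set _|; apply/setP => t; rewrite !inE tuple0.
rewrite card_tupleS (bigD1 (@None bool)) // (bigD1 up) // (bigD1 down) //= big1 ?addn0.
  have card0 : #|[set t : m.-tuple (option bool) | false]| = 0.
    by apply/eqP; rewrite cards_eq0; apply/eqP/setP => t; rewrite !inE.
  case: h => [|h] /=; rewrite !IHm card0 /=.
    rewrite !subn0 addn0; case: m {IHm card0} => [|k] //=.
    rewrite subn1 /= binS; congr (_ + _); rewrite uphalf_half.
    (* For odd [k] the flat step gives the remaining Pascal term directly, for even [k] by symmetry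
       of the binomial coefficients. *)
    case: (boolP (odd k)) => [//|/even_halfK k2].
    by rewrite add0n -[LHS]bin_sub; [congr 'C(_, _)|]; lia.
  rewrite add0n ltnS subSS.
  case: (leqP h.+2 m) => [lehm|ltmh].
    rewrite (ltnW (ltnW lehm)) addnC.
    have -> : m - h = (m - h.+2).+2 by lia.
    by rewrite /= binS addnC.
  (* Only the down step can still reach 0, and both coefficients have lower index 0. *)
  case: leqP => // lehm; rewrite add0n.
  by have -> : (m - h)./2 = 0; [lia|rewrite !bin0].
by case=> [[]|].
Qed.

(** * Heights as differences of letter counts *)

Definition ups (w : seq (option bool)) := count_mem up w.
Definition downs (w : seq (option bool)) := count_mem down w.
Arguments ups : simpl never.
Arguments downs : simpl never.

Lemma ups_cons x w : ups (x :: w) = (x == up) + ups w. Proof. by []. Qed.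
Lemma downs_cons x w : downs (x :: w) = (x == down) + downs w. Proof. by []. Qed.

(** The height before letter [g] is [h] plus the ups minus the downs of the prefix, written without
    subtraction. In this form it can be compared with cardinalities of sets of ends. *)
Lemma goodP (h : nat) (w : seq (option bool)) :
  reflect (h + ups w = downs w /\
           forall g, g < size w ->
             match nth None w g with
             | up => true
             | down => downs (take g w) < h + ups (take g w)
             | flat => downs (take g w) == h + ups (take g w)
             end)
    (good h w).
Proof.
elim: w h => [|x w IHw] h /=.
  by rewrite /ups /downs /= addn0; apply: (iffP eqP) => [->|[]].
rewrite ups_cons downs_cons /=; case: x => [[]|] /=.
- apply: (iffP (IHw h.+1)) => -[e H]; split; try lia.
    by case=> [|g] //= /H; rewrite ups_cons downs_cons /=; case: nth => [[]|]; lia.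
  move=> g /(H g.+1) /=; rewrite ups_cons downs_cons /=.
  by case: nth => [[]|]; lia.
- apply: (iffP andP) => [[h0 /IHw[e H]]|[e H]].
    split; first lia.
    case=> [|g] /=; first by rewrite /ups /downs /= addn0.
    by move/H; rewrite ups_cons downs_cons /=; case: nth => [[]|]; lia.
  have /= := H 0 isT; rewrite /ups /downs /= addn0 => h0; split=> //.
  apply/IHw; split; first lia.
  move=> g /(H g.+1) /=; rewrite ups_cons downs_cons /=.
  by case: nth => [[]|]; lia.
- apply: (iffP andP) => [[h0 /IHw[e H]]|[e H]].
    split; first lia.
    case=> [|g] /=; first by rewrite /ups /downs /= addn0 eq_sym.
    by move/H; rewrite ups_cons downs_cons /=; case: nth => [[]|]; lia.
  have /= := H 0 isT; rewrite /ups /downs /= addn0 => h0; split; first lia.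
  apply/IHw; split; first lia.
  move=> g /(H g.+1) /=; rewrite ups_cons downs_cons /=.
  by case: nth => [[]|]; lia.
Qed.

Lemma good_prefix (w : seq (option bool)) (g : nat) :
  good 0 w -> downs (take g w) <= ups (take g w).
Proof.
move=> /goodP[_ H]; elim: g => [|g IHg]; first by rewrite take0.
case: (ltnP g (size w)) => [lt_gw|le_wg].
  rewrite (take_nth None lt_gw) -cats1 /ups /downs !count_cat -/(ups _) -/(downs _).
  by have := H g lt_gw; case: nth => [[]|] /=; lia.
by move: IHg; rewrite !take_oversize // ltnW.
Qed.

(** * Ranks, and matching of left ends with right ends *)

(** By injectivity each value below [g] comes from one element; this will turn letter counts of a
    word into numbers of intervals. *)
Lemma count_iota_image (T : finType) (A : {set T}) (f : T -> nat) (g : nat) :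
  {in A &, injective f} ->
  count (fun k => [exists y in A, f y == k]) (iota 0 g) = #|[set y in A | f y < g]|.
Proof.
move=> f_inj; elim: g => [|g IHg].
  by symmetry; apply/eqP; rewrite cards_eq0; apply/eqP/setP => y; rewrite !inE andbF.
rewrite -addn1 iotaD count_cat IHg add0n addn1 /= addn0.
rewrite -(cardsID [set y in A | f y < g] [set y in A | f y < g.+1]); congr (_ + _).
  by apply: eq_card => y; rewrite !inE; case: (y \in A) => //=; lia.
case: existsP => [[y /andP[yA /eqP yg]]|noy].
  rewrite /= -(cards1 y); apply: eq_card => z; rewrite !inE.
  apply/eqP/idP => [->|]; first by rewrite yA yg ltnn /=.
  case/andP=> + /andP[zA zg]; rewrite zA /= => zng.
  by apply: f_inj => //; lia.
symmetry; apply/eqP; rewrite cards_eq0 -subset0; apply/subsetP => z; rewrite !inE.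
case/andP=> + /andP[zA zg]; rewrite zA /= => zng.
by case: noy; exists z; rewrite zA /=; lia.
Qed.

Definition rank n (S : {set 'I_n}) (k : nat) := #|[set i in S | i < k]|.

Lemma leq_rank n (S : {set 'I_n}) (k l : nat) : k <= l -> rank S k <= rank S l.
Proof.
move=> le_kl; apply/subset_leq_card/subsetP => i; rewrite !inE.
by case/andP=> -> /leq_trans->.
Qed.

Lemma index_enum_ord n (S : {set 'I_n}) (i : 'I_n) :
  i \in S -> index i (enum S) = rank S i.
Proof.
move=> iS; have -> : rank S i = count (fun k : 'I_n => k < i) (enum S).
  rewrite /rank -size_filter cardE; congr size.
  rewrite /enum_mem -filter_predI; apply: eq_filter => k.
  by rewrite /= !inE andbC.
have ltT : transitive (fun i j : 'I_n => i < j) by move=> ? ? ?; apply: ltn_trans.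
have := enum_ord_sorted S; rewrite (sorted_pairwise ltT).
have /splitPr[s1 s2] : i \in enum S by rewrite mem_enum.
rewrite pairwise_cat allrel_consr /= => /and3P[/andP[s1i _] _ /andP[is2 _]].
rewrite index_cat count_cat /= eqxx ltnn.
have /negbTE-> : i \notin s1.
  by apply/negP => /(allP s1i); rewrite ltnn.
have /eqP-> : count (fun k : 'I_n => k < i) s1 == size s1 by rewrite -all_count.
congr (_ + _); symmetry; apply/eqP; rewrite add0n -leqn0 leqNgt -has_count -all_predC.
by apply/allP => k /(allP is2) /= ik; rewrite -leqNgt ltnW.
Qed.

Lemma rank_inj n (S : {set 'I_n}) : {in S &, injective (fun i : 'I_n => rank S i)}.
Proof.
move=> i j iS jS; rewrite -!index_enum_ord // => eij.
by rewrite -[LHS](nth_index i (s := enum S)) ?mem_enum // eij nth_index ?mem_enum.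
Qed.

Lemma mem_zip_uniq (T1 T2 : eqType) (s : seq T1) (t : seq T2) a b :
    uniq s -> uniq t -> size s = size t ->
  ((a, b) \in zip s t) = [&& a \in s, b \in t & index a s == index b t].
Proof.
move=> us ut est; apply/(nthP (a, b))/and3P => [[l]|[sa tb /eqP eab]].
  rewrite size1_zip ?est // nth_zip // => lt [<- <-].
  by rewrite !mem_nth ?est // !index_uniq ?est.
exists (index a s); first by rewrite size1_zip ?est // -est index_mem.
by rewrite nth_zip // nth_index // eab nth_index.
Qed.

(* Pairs the [k]-th element of [I] with the [k]-th element of [J], for each [k]. *)
Definition matched n (I J : {set 'I_n}) : {set interval n} :=
  [set x | [&& lo x \in I, hi x \in J & rank I (lo x) == rank J (hi x)]].

(** Equal positions in the two lists become equal ranks; [antichain A] makes the lists equally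
    long. *)
Lemma LK_matched n (A : {set interval n}) : antichain A ->
  LK A = matched (~: [set hi x | x in A]) (~: [set lo x | x in A]).
Proof.
move=> acA; apply/setP => x; rewrite !inE /LK_pairs.
rewrite mem_zip_uniq ?enum_uniq ?LK_size // !mem_enum.
by apply/and3P/idP => [[]|/and3P[]]; rewrite !inE => xI xJ;
  rewrite !index_enum_ord ?inE // xI xJ.
Qed.

(** If [x] lies in [y], then [rank I (lo y) <= rank I (lo x) = rank J (hi x) <= rank J (hi y)], and
    the outer terms agree, so the ends coincide. *)
Lemma antichain_matched n (I J : {set 'I_n}) : antichain (matched I J).
Proof.
apply/forall_inP => x; rewrite inE => /and3P[lxI hxJ /eqP ex].
apply/forall_inP => y; rewrite inE => /and3P[lyI hyJ /eqP ey].
apply/implyP; change (interval_le x y -> x == y); rewrite interval_leE.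
case/andP => lyx hxy.
have := leq_rank I lyx; have := leq_rank J hxy; rewrite ey ex => h1 h2.
have e : rank J (hi x) = rank J (hi y) by apply/eqP; rewrite eqn_leq h1 h2.
apply/eqP/interval_le_anti; rewrite !interval_leE.
have -> : lo x = lo y by apply: (rank_inj lxI lyI); rewrite ex ey.
by rewrite (rank_inj hxJ hyJ e) !leqnn.
Qed.

Lemma ltn_lo_hi n (A : {set interval n}) x y : antichain A ->
  x \in A -> y \in A -> (lo x < lo y) = (hi x < hi y).
Proof.
move=> acA xA yA; apply/idP/idP => lt; rewrite ltnNge; apply/negP => le.
  have := antichainP acA yA xA; rewrite interval_leE le ltnW // => /(_ isT) e.
  by rewrite e ltnn in lt.
have := antichainP acA xA yA; rewrite interval_leE le ltnW // => /(_ isT) e.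
by rewrite e ltnn in lt.
Qed.

(** The members starting before [x] are those ending before [x], and either end determines a
    member. *)
Lemma rank_lo_hi n (A : {set interval n}) x : antichain A -> x \in A ->
  rank [set lo y | y in A] (lo x) = rank [set hi y | y in A] (hi x).
Proof.
move=> acA xA; pose B := [set y in A | lo y < lo x].
have subBA : {subset B <= A} by move=> y; rewrite inE => /andP[].
have -> : rank [set lo y | y in A] (lo x) = #|[set lo y | y in B]|.
  apply: eq_card => k; rewrite inE; apply/andP/imsetP => [[/imsetP[y yA ->] lt]|[y]].
    by exists y => //; rewrite inE yA.
  by rewrite inE => /andP[yA lt] ->; rewrite imset_f.
have -> : rank [set hi y | y in A] (hi x) = #|[set hi y | y in B]|.
  apply: eq_card => k; rewrite inE; apply/andP/imsetP => [[/imsetP[y yA ->] lt]|[y]].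
    by exists y => //; rewrite inE yA (ltn_lo_hi acA).
  by rewrite inE => /andP[yA lt] ->; rewrite imset_f // -(ltn_lo_hi acA).
rewrite !card_in_imset // => y z /subBA yA /subBA zA.
  exact: (hi_inj_in acA).
exact: (lo_inj_in acA).
Qed.

(** Both ends order an antichain in the same way, so its two sets of ends determine it. *)
Lemma matched_id n (A : {set interval n}) : antichain A ->
  matched [set lo x | x in A] [set hi x | x in A] = A.
Proof.
move=> acA; apply/setP => x; rewrite inE; apply/and3P/idP => [|xA]; last first.
  by rewrite !imset_f // rank_lo_hi.
case=> /imsetP[y yA exy] /imsetP[z zA exz]; rewrite exy exz rank_lo_hi // => /eqP.
move/(rank_inj (imset_f _ yA) (imset_f _ zA)) => eyz.
suff -> : x = y by [].
by apply: interval_le_anti; rewrite !interval_leE exy exz eyz !leqnn.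
Qed.

(** The second hypothesis makes every zipped pair an interval, so neither set loses a point. *)
Lemma matched_ends n (I J : {set 'I_n}) : #|I| = #|J| ->
    (forall p, p \in zip (enum I) (enum J) -> p.1 <= p.2) ->
  [set lo x | x in matched I J] = I /\ [set hi x | x in matched I J] = J.
Proof.
move=> eIJ le_zip; have zipI p : p \in zip (enum I) (enum J) ->
    exists2 x, x \in matched I J & (lo x, hi x) = p.
  move=> pz; have le_p := le_zip p pz.
  exists (Interval le_p); last by case: (p) le_p.
  rewrite inE; case: p pz le_p => a b pz le_p; move: pz.
  rewrite mem_zip_uniq ?enum_uniq -?cardE // !mem_enum => /and3P[aI bJ].
  by rewrite !index_enum_ord // => e; apply/and3P.
have es : size (enum I) = size (enum J) by rewrite -!cardE.
split; apply/setP => i; apply/imsetP/idP => [[x]|iS].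
- by rewrite inE => /and3P[lxI _ _] ->.
- have : i \in unzip1 (zip (enum I) (enum J)) by rewrite unzip1_zip ?es // mem_enum.
  by case/mapP=> p /zipI[x xIJ <-] ->; exists x.
- by rewrite inE => /and3P[_ hxJ _] ->.
- have : i \in unzip2 (zip (enum I) (enum J)) by rewrite unzip2_zip ?es // mem_enum.
  by case/mapP=> p /zipI[x xIJ <-] ->; exists x.
Qed.

(** * Marks at the gaps, and the ends of [rowA A] *)

(* The gap [g] lies between the points coded by [g - 1] and [g]. *)
Definition starts n (A : {set interval n}) (g : nat) : bool :=
  [exists y in A, lo y == g :> nat].
Definition ends n (A : {set interval n}) (g : nat) : bool :=
  [exists y in A, (hi y).+1 == g].
(** Here [k] is a point: gap [k] lies before it and gap [k.+1] after it. *)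
Definition covers n (A : {set interval n}) (k : nat) : bool :=
  [exists y in A, lo y <= k <= hi y].

Lemma mem_los n (A : {set interval n}) (i : 'I_n) :
  (i \in [set lo y | y in A]) = starts A i.
Proof.
apply/imsetP/exists_inP => [[y yA ->]|[y yA /eqP e]]; exists y => //.
exact/esym/val_inj.
Qed.

Lemma mem_his n (A : {set interval n}) (i : 'I_n) :
  (i \in [set hi y | y in A]) = ends A i.+1.
Proof.
apply/imsetP/exists_inP => [[y yA ->]|[y yA /eqP[e]]]; exists y => //.
exact/esym/val_inj.
Qed.

Lemma antichain_minimals (d : Order.disp_t) (T : finPOrderType d) (S : {set T}) :
  antichain (minimals S).
Proof.
apply/forall_inP => x; rewrite inE => /andP[xS _].
by apply/forall_inP => y; rewrite inE => /andP[_ /forall_inP/(_ x xS)].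
Qed.

Lemma le_intervalE n (x y : interval n) :
  (x <= y)%O = (lo y <= lo x) && (hi x <= hi y).
Proof. exact: interval_leE. Qed.

Lemma interval_of n (a b : 'I_n) : a <= b -> {x : interval n | lo x = a & hi x = b}.
Proof. by move=> ab; exists (@Interval n (a, b) ab). Qed.

(** Membership of the interval from [a] to [b] in the set whose minimal elements form [rowA A];
    bounds in [nat] allow arithmetic on ends. *)
Definition escapes n (A : {set interval n}) (a b : nat) : bool :=
  [forall y in A, ~~ ((lo y <= a) && (b <= hi y))].

Lemma rowAP n (A : {set interval n}) (x : interval n) :
  reflect (escapes A (lo x) (hi x) /\
           forall a b, lo x <= a -> a <= b -> b <= hi x -> escapes A a b ->
             a = lo x /\ b = hi x)
    (x \in rowA A).
Proof.
have memS y : (y \in [set z | [forall u in A, ~~ (z <= u)%O]]) = escapes A (lo y) (hi y).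
  by rewrite inE; apply: eq_forallb => u; rewrite le_intervalE.
rewrite inE memS; apply: (iffP andP) => -[xS Hx]; split => //.
  move=> a b xa ab bx abS.
  have bn := leq_ltn_trans bx (ltn_ord (hi x)).
  have an := leq_ltn_trans ab bn.
  have [z lz hz] := @interval_of n (Ordinal an) (Ordinal bn) ab.
  have := forall_inP Hx z; rewrite memS le_intervalE lz hz /= xa bx.
  by move=> /(_ abS) /eqP e; rewrite -e lz hz.
apply/forall_inP => y; rewrite memS le_intervalE => yS; apply/implyP => /andP[xy yx].
have [e1 e2] := Hx _ _ xy (valP y) yx yS.
by apply/eqP/interval_le_anti; rewrite !interval_leE e1 e2 !leqnn.
Qed.

Lemma escapes_covers n (A : {set interval n}) (k : nat) :
  escapes A k k = ~~ covers A k.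
Proof. by rewrite negb_exists_in. Qed.

(** A member containing the interval from [a] to [b] would contain [y], hence be [y], and the bounds
    would be those of [y]. *)
Lemma escapes_extend n (A : {set interval n}) (y : interval n) (a b : nat) :
    antichain A -> y \in A -> a <= lo y -> hi y <= b -> (a, b) != (lo y : nat, hi y : nat) ->
  escapes A a b.
Proof.
move=> acA yA ay yb; apply: contraNT; rewrite negb_forall_in => /exists_inP[z zA].
rewrite negbK => /andP[za bz]; have := antichainP acA yA zA.
rewrite interval_leE (leq_trans za ay) (leq_trans yb bz) => /(_ isT) eyz.
by rewrite xpair_eqE !eqn_leq ay yb [in lo y]eyz za [in hi y]eyz bz.
Qed.

(** If [x] in [rowA A] ends at a covered point, removing that point puts it inside a member of [A],
    which must end one step earlier. Conversely, the largest [a] such that the interval from [a] to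
    [h] escapes is the left end of the required minimal interval. *)
Lemma ends_rowA n (A : {set interval n}) (h : 'I_n) : antichain A ->
  ends (rowA A) h.+1 = ~~ covers A h || ends A h.
Proof.
move=> acA; rewrite -mem_his; apply/imsetP/orP => [[x /rowAP[/forall_inP xS Hx] ->]|hA].
  case: (boolP (covers A (hi x))) => [/exists_inP[z zA /andP[lz hz]]|]; last by left.
  right; have := xS z zA; rewrite hz andbT -ltnNge => lxz.
  (* By [lxz] the interval [x] has a second point, so the shortened one is nonempty. *)
  case: (boolP (escapes A (lo x) (hi x).-1)) => [/(Hx _ _ (leqnn _))|].
    by case; lia.
  rewrite negb_forall_in => /exists_inP[y yA]; rewrite negbK => /andP[lyx hxy].
  by apply/exists_inP; exists y => //; have := xS y yA; rewrite lyx /=; lia.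
have endS y : y \in A -> (hi y).+1 = h -> lo y <= h /\ escapes A (lo y) h.
  move=> yA e; have ley : lo y <= hi y := valP y; split; first by lia.
  by apply: (escapes_extend acA yA) => //; rewrite -e ?xpair_eqE ?eqxx ?gtn_eqF.
have ex : exists a, (a <= h) && escapes A a h.
  case: hA => [hA|/exists_inP[y yA /eqP/(endS _ yA)[yh yS]]].
    by exists h; rewrite leqnn escapes_covers.
  by exists (lo y); rewrite yh.
have ub a : (a <= h) && escapes A a h -> a <= h by case/andP.
case: (ex_maxnP ex ub) => a /andP[ah aS] amax.
have [x lx hx] := @interval_of n (Ordinal (leq_ltn_trans ah (ltn_ord h))) h ah.
exists x => //; apply/rowAP; rewrite lx hx /=; split=> // a' b' aa' ab' bh' S'.
have [eb|ltb] := eqVneq b' h.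
  have := amax a'; rewrite -{2}eb S' -eb ab' eb => /(_ isT) a'a.
  by split=> //; apply/eqP; rewrite eqn_leq a'a.
(* Now [b' < h]. An uncovered [h] would force [a = h], beyond [b']; a member ending at [h - 1] would
   contain the interval from [a'] to [b']. *)
case: hA => [|/exists_inP[y yA /eqP e]].
  by rewrite -escapes_covers => hS; have := amax h; rewrite leqnn hS => /(_ isT); lia.
have [yh yS] := endS y yA e.
have ly : lo y <= a by apply: amax; rewrite yh.
by have := forall_inP S' y yA; rewrite (leq_trans ly aa') /=; lia.
Qed.

(** Mirror image of [ends_rowA], with the least right bound; [b < n] is carried along so that it
    codes a point. *)
Lemma starts_rowA n (A : {set interval n}) (h : 'I_n) : antichain A ->
  starts (rowA A) h = ~~ covers A h || starts A h.+1.
Proof.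
move=> acA; rewrite -mem_los; apply/imsetP/orP => [[x /rowAP[/forall_inP xS Hx] ->]|hA].
  case: (boolP (covers A (lo x))) => [/exists_inP[z zA /andP[lz hz]]|]; last by left.
  right; have := xS z zA; rewrite lz /= -ltnNge => hzx.
  case: (boolP (escapes A (lo x).+1 (hi x))) => [S'|].
    by have [] := Hx _ _ (leqnSn _) (leq_ltn_trans hz hzx) (leqnn _) S'; lia.
  rewrite negb_forall_in => /exists_inP[y yA]; rewrite negbK => /andP[lyx hxy].
  by apply/exists_inP; exists y => //; have := xS y yA; rewrite hxy andbT; lia.
have startS y : y \in A -> lo y = h.+1 :> nat -> h <= hi y /\ escapes A h (hi y).
  move=> yA e; have ley : lo y <= hi y := valP y; split; first by lia.
  by apply: (escapes_extend acA yA) => //; rewrite ?xpair_eqE e ?(ltn_eqF (ltnSn h)).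
have ex : exists b, [&& h <= b, b < n & escapes A h b].
  case: hA => [hA|/exists_inP[y yA /eqP/(startS _ yA)[yh yS]]].
    by exists h; rewrite leqnn escapes_covers ltn_ord.
  by exists (hi y); rewrite yh ltn_ord.
case: (ex_minnP ex) => b /and3P[hb bn bS] bmin.
have [x lx hx] := @interval_of n h (Ordinal bn) hb.
exists x => //; apply/rowAP; rewrite lx hx /=; split=> // a' b' ha' ab' bb' S'.
have [ea|lta] := eqVneq a' h.
  have := bmin b'; rewrite -{2}ea S' -ea ab' (leq_ltn_trans bb' bn) => /(_ isT) b'b.
  by split=> //; apply/eqP; rewrite eqn_leq bb'.
case: hA => [|/exists_inP[y yA /eqP e]].
  rewrite -escapes_covers => hS; have := bmin h.
  by rewrite leqnn ltn_ord hS => /(_ isT); lia.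
have [yh yS] := startS y yA e.
have hy : b <= hi y by apply: bmin; rewrite yh ltn_ord.
by have := forall_inP S' y yA; rewrite (leq_trans bb' hy) andbT; lia.
Qed.

(** * The fixed-point condition read at the gaps *)

(** Equality of left ends is a condition at the gap before each covered point, equality of right
    ends one at the gap after it. *)
Lemma LK_rowA_fixedP n (A : {set interval n}) : antichain A ->
  reflect (forall y g, y \in A -> lo y <= g <= (hi y).+1 -> starts A g (+) ends A g)
    (LK (rowA A) == A).
Proof.
move=> acA; have acR : antichain (rowA A) := antichain_minimals _.
rewrite LK_matched //; set I := ~: _; set J := ~: _.
have eqI : (I == [set lo x | x in A]) =
    [forall h : 'I_n, covers A h ==> starts A h (+) ends A h].
  apply/eqP/forallP => [eI h|HI].
    have := mem_los A h; rewrite -eI inE mem_his ends_rowA // => <-.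
    by case: covers => //=; case: ends.
  apply/setP => h; rewrite mem_los inE mem_his ends_rowA //.
  have := HI h; case: (boolP (covers A h)) => /=; first by case: ends; case: starts.
  (* At an uncovered point both sides are false, since an interval starting there would cover it. *)
  move=> nc _; apply/esym/exists_inP => -[y yA /eqP e]; case/exists_inP: nc.
  by exists y => //; rewrite -e leqnn; apply: (valP y).
have eqJ : (J == [set hi x | x in A]) =
    [forall h : 'I_n, covers A h ==> starts A h.+1 (+) ends A h.+1].
  apply/eqP/forallP => [eJ h|HJ].
    have := mem_his A h; rewrite -eJ inE mem_los starts_rowA // => <-.
    by case: covers => //=; case: starts.
  apply/setP => h; rewrite mem_his inE mem_los starts_rowA //.
  have := HJ h; case: (boolP (covers A h)) => /=; first by case: ends; case: starts.
  move=> nc _; apply/esym/exists_inP => -[y yA /eqP[e]]; case/exists_inP: nc.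
  by exists y => //; rewrite -e leqnn andbT; apply: (valP y).
(* Both sides are antichains, so it suffices to compare their sets of ends. *)
have -> : (matched I J == A) = (I == [set lo x | x in A]) && (J == [set hi x | x in A]).
  apply/eqP/andP => [eA|[/eqP-> /eqP->]]; last exact: matched_id.
  have [] : [set lo x | x in matched I J] = I /\ [set hi x | x in matched I J] = J.
    by apply: matched_ends => [|p]; [rewrite !cardE; apply: LK_size|apply: LK_pairs_interval].
  by rewrite eA => -> ->.
rewrite eqI eqJ; apply: (iffP andP) => [[/forallP HI /forallP HJ] y g yA|H].
  (* Left ends handle the gaps from [lo y] to [hi y], right ends the last gap [(hi y).+1]. *)
  case/andP=> yg gy; case: (leqP g (hi y)) => gh.
    have := HI (Ordinal (leq_ltn_trans gh (ltn_ord _))) => /implyP /=; apply.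
    by apply/exists_inP; exists y; rewrite ?yg.
  have -> : g = (hi y).+1 by apply/eqP; rewrite eqn_leq gy.
  apply: (implyP (HJ (hi y))); apply/exists_inP; exists y => //.
  by rewrite leqnn andbT; apply: (valP y).
split; apply/forallP => h; apply/implyP => /exists_inP[y yA /andP[lh hh]]; apply: (H y) => //.
  by rewrite lh leqW.
by rewrite leqW.
Qed.

(** * The word of an antichain *)

(** A gap with both marks reads [up]; when no gap has both, the word records every mark. *)
Definition letter n (A : {set interval n}) (g : nat) : option bool :=
  if starts A g then up else if ends A g then down else flat.

Definition word n (A : {set interval n}) : n.+1.-tuple (option bool) :=
  [tuple of [seq letter A g | g <- iota 0 n.+1]].

Section Word.
Variables (n : nat) (A : {set interval n}).
Hypothesis acA : antichain A.
Hypothesis disjA : forall g, starts A g -> ~~ ends A g.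

Lemma letter_up g : (letter A g == up) = starts A g.
Proof. by rewrite /letter; case: (starts A g); case: (ends A g). Qed.

Lemma letter_down g : (letter A g == down) = ends A g.
Proof. by rewrite /letter; case: (boolP (starts A g)) => [/disjA|]; case: (ends A g). Qed.

Lemma nth_word g : g <= n -> nth None (word A) g = letter A g.
Proof. by move=> gn; rewrite (nth_map 0) ?size_iota // nth_iota. Qed.

Lemma take_word g : g <= n.+1 -> take g (word A) = map (letter A) (iota 0 g).
Proof. by move=> gn; rewrite -[tval _]/(map _ _) -map_take take_iota (minn_idPl gn). Qed.

Lemma ups_word g : g <= n.+1 -> ups (take g (word A)) = #|[set y in A | lo y < g]|.
Proof.
move=> gn; rewrite take_word // /ups count_map -(count_iota_image (f := fun y => lo y)).
  by apply: eq_count => k; rewrite /= letter_up.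
by move=> y z yA zA /val_inj; apply: (lo_inj_in acA).
Qed.

Lemma downs_word g :
  g <= n.+1 -> downs (take g (word A)) = #|[set y in A | (hi y).+1 < g]|.
Proof.
move=> gn; rewrite take_word // /downs count_map.
rewrite -(count_iota_image (f := fun y => (hi y).+1)).
  by apply: eq_count => k; rewrite /= letter_down.
by move=> y z yA zA [/val_inj]; apply: (hi_inj_in acA).
Qed.

(** The difference of these sets consists of the members open at [g], with [lo y < g <= (hi y).+1];
    its size is the height before letter [g]. *)
Lemma sub_hi_lo g : [set y in A | (hi y).+1 < g] \subset [set y in A | lo y < g].
Proof.
apply/subsetP => y; rewrite !inE => /andP[-> hy] /=.
by have ley : lo y <= hi y := valP y; lia.
Qed.

(** A member ending just before gap [g] is open at [g], so a down letter meets positive height; at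
    an unmarked gap no member is open, so the height is 0. *)
Lemma good_word :
  (forall y g, y \in A -> lo y <= g <= (hi y).+1 -> starts A g (+) ends A g) ->
  good 0 (word A).
Proof.
move=> fixA; apply/goodP; split=> [|g]; rewrite ?size_tuple add0n.
  have sz : size (word A) <= n.+1 by rewrite size_tuple.
  rewrite -(take_oversize sz) ups_word // downs_word //; apply: eq_card => y.
  by rewrite !inE !ltnS ltn_ord ltnW.
rewrite ltnS => gn; rewrite nth_word // ups_word ?downs_word ?(leqW gn) //.
rewrite /letter; case: (boolP (starts A g)) => // sA.
case: (boolP (ends A g)) => [/exists_inP[y yA /eqP e]|eA].
  apply: proper_card; rewrite properE sub_hi_lo; apply/subsetPn; exists y; rewrite !inE yA ?e.
    by have ley : lo y <= hi y := valP y; rewrite -e ltnS.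
  by rewrite ltnn.
apply/eqP/eq_card => y; rewrite !inE; case: (boolP (y \in A)) => //= yA.
apply/idP/idP => [|lg]; first by have ley : lo y <= hi y := valP y; lia.
rewrite ltnNge; apply/negP => gh; have := fixA y g yA.
by rewrite (ltnW lg) gh (negbTE sA) (negbTE eA) => /(_ isT).
Qed.

(** Only an unmarked gap needs an argument: height 0 leaves no open member there, yet [y], not
    starting at [g], would be open. *)
Lemma word_good :
    good 0 (word A) ->
  forall y g, y \in A -> lo y <= g <= (hi y).+1 -> starts A g (+) ends A g.
Proof.
move=> /goodP[_ goodA] y g yA /andP[lg gh].
have gn : g <= n by apply: leq_trans gh (ltn_ord _).
have := goodA g; rewrite size_tuple ltnS gn nth_word // add0n => /(_ isT).
rewrite ups_word ?downs_word ?(leqW gn) // /letter.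
case: (boolP (starts A g)) => [/disjA/negbTE-> //|sA]; case: (ends A g) => //= /eqP eqc.
have /eqP eqs : [set y in A | (hi y).+1 < g] == [set y in A | lo y < g].
  by rewrite eqEcard sub_hi_lo eqc leqnn.
have : y \in [set y in A | lo y < g].
  rewrite inE yA ltn_neqAle lg andbT; apply: contra sA => e.
  by apply/exists_inP; exists y.
by rewrite -eqs inE yA ltnNge gh.
Qed.

End Word.

(** * The bijection between fixed antichains and words *)

Lemma fixed_disjoint n (A : {set interval n}) :
    (forall y g, y \in A -> lo y <= g <= (hi y).+1 -> starts A g (+) ends A g) ->
  forall g, starts A g -> ~~ ends A g.
Proof.
move=> fixA g sA; have /exists_inP[y yA /eqP e] := sA.
have ley : lo y <= hi y := valP y.
by have := fixA y g yA; rewrite sA -e leqnn leqW // => /(_ isT).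
Qed.

(** The letters give both sets of ends, which determine an antichain by [matched_id]. *)
Lemma word_inj n (A B : {set interval n}) : antichain A -> antichain B ->
    (forall g, starts A g -> ~~ ends A g) -> (forall g, starts B g -> ~~ ends B g) ->
  word A = word B -> A = B.
Proof.
move=> acA acB dA dB eAB.
have eL g : g <= n -> letter A g = letter B g by move=> gn; rewrite -!nth_word // eAB.
rewrite -(matched_id acA) -(matched_id acB); congr (matched _ _); apply/setP => i.
  by rewrite !mem_los -!letter_up eL // ltnW.
by rewrite !mem_his -!letter_down // eL.
Qed.

(** Points after up gaps serve as left ends, points before down gaps as right ends; matching them by
    rank gives the antichain. *)
Lemma word_surj n (w : n.+1.-tuple (option bool)) : good 0 w ->
  exists A : {set interval n},
    [/\ antichain A, forall g, starts A g -> ~~ ends A g & word A = w].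
Proof.
move=> goodw; have [tot letw] := goodP _ _ goodw; rewrite add0n in tot.
have szw : size w = n.+1 := size_tuple w.
pose I := [set i : 'I_n | nth None w i == up].
pose J := [set j : 'I_n | nth None w j.+1 == down].
have takeE g : g <= n.+1 -> take g w = [seq nth None w k | k <- iota 0 g].
  by move=> gn; rewrite map_nth_iota0 ?szw.
(* Points are coded below [n], so [I] and [J] would miss an up at gap [n] and a down at gap 0; a
   path has neither. *)
have w0 : nth None w 0 != down.
  by apply/negP => /eqP e; have := letw 0; rewrite szw e take0 => /(_ isT).
have wn : nth None w n != up.
  apply/negP => /eqP e; have := good_prefix n goodw; move: tot.
  have ew : w = rcons (take n w) up :> seq _.
    by rewrite -e -take_nth ?szw // take_oversize ?szw.
  by rewrite {1 2}ew -cats1 /ups /downs !count_cat -/(ups _) -/(downs _) /=; lia.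
have upsI g : g <= n.+1 -> ups (take g w) = #|[set i in I | i < g]|.
  move=> gn; rewrite takeE // /ups count_map -(count_iota_image (f := fun i : 'I_n => i : nat)).
    apply: eq_in_count => k; rewrite mem_iota add0n /= => kg.
    apply/idP/exists_inP => [wk|[i + /eqP<-]]; last by rewrite inE.
    have kn : k < n.
      rewrite ltn_neqAle -ltnS (leq_trans kg gn) andbT.
      by apply: contraL wk => /eqP->.
    by exists (Ordinal kn); rewrite ?inE.
  by move=> i j _ _ /val_inj.
have downsJ g : g <= n.+1 -> downs (take g w) = #|[set j in J | j.+1 < g]|.
  move=> gn; rewrite takeE // /downs count_map -(count_iota_image (f := fun i : 'I_n => i.+1)).
    apply: eq_in_count => k; rewrite mem_iota add0n /= => kg.
    apply/idP/exists_inP => [wk|[i + /eqP<-]]; last by rewrite inE.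
    case: k kg wk => [|k] kg wk; first by rewrite (negbTE w0) in wk.
    have kn : k < n by rewrite -ltnS (leq_trans kg gn).
    by exists (Ordinal kn); rewrite ?inE.
  by move=> i j _ _ [/val_inj].
have setE (S : {set 'I_n}) (P : pred 'I_n) : P =1 xpredT -> [set i in S | P i] = S.
  by move=> PT; apply/setP => i; rewrite inE PT andbT.
have [losA hisA] : [set lo x | x in matched I J] = I /\ [set hi x | x in matched I J] = J.
  apply: matched_ends.
    have := tot; rewrite -(take_oversize (s := w) (n := n.+1)) ?szw // upsI // downsJ //.
    by rewrite !setE // => i; rewrite ?ltnS ?ltn_ord // ltnW.
  move=> p; apply: zip_enum_leq => t; have tn := ltn_ord t.
  (* Right ends up to [t] are downs among [t.+2] letters, left ends are ups among [t.+1]; the extra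
     letter, if down, uses up a positive height. *)
  change (#|[set j in J | j.+1 < t.+2]| <= #|[set i in I | i < t.+1]|).
  rewrite -downsJ // -upsI ?(leqW tn) // (take_nth None) ?szw //.
  rewrite -cats1 /downs count_cat -/(downs _) /= addn0.
  have := letw t.+1; rewrite szw ltnS tn => /(_ isT); have := good_prefix t.+1 goodw.
  by case: nth => [[]|] /=; lia.
exists (matched I J).
have stE g : g <= n -> starts (matched I J) g = (nth None w g == up).
  rewrite leq_eqVlt => /orP[/eqP->|gn]; last first.
    by rewrite -[g]/(val (Ordinal gn)) -mem_los losA inE.
  rewrite (negbTE wn); apply/exists_inP => -[y _ /eqP e].
  by have := ltn_ord (lo y); rewrite e ltnn.
have enE g : g <= n -> ends (matched I J) g = (nth None w g == down).
  case: g => [_|g gn].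
    by rewrite (negbTE w0); apply/exists_inP => -[].
  by rewrite -[g]/(val (Ordinal gn)) -mem_his hisA inE.
split; first exact: antichain_matched.
  move=> g sg; case: (leqP g n) => gn; first by move: sg; rewrite stE // enE // => /eqP->.
  by case/exists_inP: sg => y _ /eqP e; have := ltn_ord (lo y); rewrite e; lia.
apply/val_inj/(@eq_from_nth _ None) => [|g]; first by rewrite /= size_map size_iota szw.
rewrite size_tuple ltnS => gn; rewrite nth_word // /letter stE // enE //.
by case: nth => [[]|].
Qed.

Theorem theorem6p2 (n : nat) (hn : 1 <= n) :
  #|[set A : {set interval n} | antichain A && (LK (rowA A) == A)]|
    = 'C(n.+1, (n.+1)./2).
Proof.
set S := [set A | _]; have SP A : A \in S -> antichain A /\
    forall y g, y \in A -> lo y <= g <= (hi y).+1 -> starts A g (+) ends A g.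
  by rewrite inE => /andP[acA /(LK_rowA_fixedP acA)].
have inj : {in S &, injective (@word n)}.
  move=> A B /SP[acA fA] /SP[acB fB].
  by apply: word_inj => //; apply: fixed_disjoint.
(* It remains to see that the words of the fixed antichains are exactly the paths of length [n.+1]
   from height 0. *)
rewrite -(card_in_imset inj) -[RHS](card_good n.+1 0).
apply: eq_card => w; rewrite inE; apply/imsetP/idP => [[A /SP[acA fA] ->]|].
  by apply: good_word => //; apply: fixed_disjoint.
move=> goodw; have [A [acA dA eA]] := word_surj goodw.
exists A => //; rewrite inE acA; apply/(LK_rowA_fixedP acA).
by apply: word_good; rewrite ?eA.
Qed.
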